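(* Let $G$ be an amenable semigroup with neutral element $e$, and let $\sigma: G\to G$ be an involution of $G$. Let $f: G\to\mathbb{C}$ be a function satisfying, for some nonnegative $\delta$, $$|f(xy)+f(x\sigma(y))-2f(x)|\le\delta\quad\text{for all } x,y\in G.$$ Then there exists a unique solution $g: G\to\mathbb{C}$ of the Jensen functional equation $$g(xy)+g(x\sigma(y))=2g(x)\quad\text{for all } x,y\in G$$ such that $$|f(x)-g(x)-f(e)|\le 3\delta\quad\text{for all } x\in G.$$
   Context: An involution of a semigroup $G$ is a map $\sigma: G\to G$ with $\sigma(xy)=\sigma(y)\sigma(x)$ and $\sigma(\sigma(x))=x$ for all $x,y\in G$. The semigroup $G$ is amenable if there exists an invariant mean on the space of bounded complex-valued functions on $G$, i.e. a linear functional $m$ on that space with $m(1)=\|m\|=1$ that is invariant under both left translations $x\mapsto h(yx)$ and right translations $x\mapsto h(xy)$ of each bounded function $h$, for every $y\in G$.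
   Formalization: Uniqueness is proved for solutions normalized by g(e)=0, and up to an additive constant without that; literal uniqueness fails for δ>0 (f=0, δ=1: both g=0 and g=1 satisfy the Jensen equation and the bound). *)

(* Defs.v *)
From mathcomp Require Import all_boot all_order all_algebra.
From mathcomp Require Import all_classical all_reals all_analysis.
From mathcomp Require Export complex.

Set Implicit Arguments.
Unset Strict Implicit.
Unset Printing Implicit Defensive.

Import Order.TTheory GRing.Theory Num.Theory.
Import numFieldNormedType.Exports.

Local Open Scope classical_set_scope.
Local Open Scope ring_scope.
Local Open Scope complex_scope.

Definition is_involution (G : semigroupType) (sigma : G -> G) : Prop :=
  (forall x y : G, sigma (x * y)%g = (sigma y * sigma x)%g) /\
  (forall x : G, sigma (sigma x) = x).

(* The norm of [m] as a functional on the bounded functions with the supremum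
   norm.  [sup] is 0 on unbounded sets, so that a nonzero value of [mean_norm]
   entails that [m] is continuous. *)
Definition mean_norm (R : realType) (G : Type)
    (m : (G -> R[i]) -> R[i]) : R :=
  sup [set complex.Re `|m h| | h in [set h : G -> R[i] | forall x, `|h x| <= 1]].

(* A functional on the bounded functions is encoded as a total map on all
   functions, about which nothing is required outside the bounded ones. *)
Definition is_invariant_mean (R : realType) (G : semigroupType)
    (m : (G -> R[i]) -> R[i]) : Prop :=
  [/\ forall (a : R[i]) (h k : G -> R[i]), bounded_fun (h : G -> R[i]^o) -> bounded_fun (k : G -> R[i]^o) ->
        m (fun x => a * h x + k x) = a * m h + m k,
      m (fun=> 1) = 1,
      mean_norm m = 1,
      forall (y : G) (h : G -> R[i]), bounded_fun (h : G -> R[i]^o) ->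
        m (fun x => h (y * x)%g) = m h &
      forall (y : G) (h : G -> R[i]), bounded_fun (h : G -> R[i]^o) ->
        m (fun x => h (x * y)%g) = m h].

Definition amenable (R : realType) (G : semigroupType) : Prop :=
  exists m : (G -> R[i]) -> R[i], is_invariant_mean m.

Definition jensen (R : realType) (G : semigroupType) (sigma : G -> G)
    (g : G -> R[i]) : Prop :=
  forall x y : G, g (x * y)%g + g (x * sigma y)%g = 2 * g x.

(* Main.v *)
Require Import Defs.
From mathcomp Require Import all_boot all_order all_algebra.
From mathcomp Require Import all_classical all_reals all_analysis.
From mathcomp Require Import ring lra.

Import Order.TTheory GRing.Theory Num.Theory.
Local Open Scope ring_scope.
Local Open Scope complex_scope.

(* Write [d(x, z) = f(xz) + f(x sigma(z)) - 2 f(x)] for the defect of [f] and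
   average: [T f(x) = m_y (f(xy) + f(x sigma(y))) / 2], which is within
   [delta / 2] of [f].  Expanding [f(xzy) + f(xz sigma(y)) + f(x sigma(z) y) +
   f(x sigma(z) sigma(y))] and using that the mean is invariant on both sides,
   the defect of [T f] at [(x, z)] is [- m_y (d(y, z) + d(sigma(y), z)) / 2],
   which does not depend on [x]; call it [- c(z)].  Doing this twice, the defect
   of [T (T f)] is [c(z)], while [T (T f)] differs from [T f] by a constant and
   so has defect [- c(z)].  Hence [c = 0] and [T f] solves Jensen's equation.

   A solution [h] with [h(1) = 0] satisfies [h(x^2) = 2 h(x)], so it vanishes
   when it is bounded; this gives uniqueness. *)

Definition bounded_by {R : realType} {T : Type} (B : R) (h : T -> R[i]) : Prop :=
  forall x, `|h x| <= B%:C.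

Definition jdefect {R : realType} {G : semigroupType} (sigma : G -> G)
    (F : G -> R[i]) (x z : G) : R[i] :=
  F (x * z)%g + F (x * sigma z)%g - 2 * F x.

Definition javg {R : realType} {G : semigroupType} (m : (G -> R[i]) -> R[i])
    (sigma : G -> G) (F : G -> R[i]) (x : G) : R[i] :=
  2^-1 * m (fun y => F (x * y)%g + F (x * sigma y)%g).

(** * Functions bounded by an explicit real constant *)

Section BoundedBy.
Set Implicit Arguments.
Unset Strict Implicit.
Variables (R : realType) (T : Type).
Implicit Types (h k : T -> R[i]) (B C : R).

Lemma bounded_by_bounded_fun B h :
  bounded_by B h -> bounded_fun (h : T -> R[i]^o).
Proof.
move=> hB; exists B%:C; split; first by apply/complex_realP; exists B.
by move=> M /ltW BM x _; exact: le_trans (hB x) BM.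
Qed.

Lemma bounded_byD B C h k : bounded_by B h -> bounded_by C k ->
  bounded_by (B + C) (fun x => h x + k x).
Proof.
by move=> hB kC x; rewrite rmorphD (le_trans (ler_normD _ _)) ?lerD.
Qed.

Lemma bounded_byZ B (a : R[i]) h : bounded_by B h ->
  bounded_by (complex.Re `|a| * B) (fun x => a * h x).
Proof.
move=> hB x; rewrite normrM rmorphM /= [_%:C](RRe_real (normr_real a)).
by rewrite ler_wpM2l.
Qed.

Lemma bounded_by_cst (a : R[i]) : bounded_by (complex.Re `|a|) (fun _ : T => a).
Proof. by move=> x; rewrite RRe_real ?normr_real. Qed.

End BoundedBy.

(** * Linearity, invariance and norm estimate of the mean on bounded functions *)

Section Mean.
Set Implicit Arguments.
Unset Strict Implicit.
Variables (R : realType) (G : semigroupType) (m : (G -> R[i]) -> R[i]).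
Hypothesis mP : is_invariant_mean m.
Implicit Types (h k : G -> R[i]) (B C : R).

Lemma mean0 : m (fun=> 0) = 0.
Proof.
have [+ _ _ _ _] := mP.
have b0 := @bounded_by_bounded_fun R G _ _ (@bounded_by_cst R G 0).
move=> /(_ 1 _ _ b0 b0); rewrite !mul1r addr0.
by move=> /(congr1 (fun t => t - m (fun=> 0))); rewrite subrr addrK.
Qed.

Lemma meanD B C h k : bounded_by B h -> bounded_by C k ->
  m (fun x => h x + k x) = m h + m k.
Proof.
move=> /bounded_by_bounded_fun bh /bounded_by_bounded_fun bk.
have [+ _ _ _ _] := mP => /(_ 1 _ _ bh bk); rewrite mul1r => <-.
by congr m; apply/funext => x; rewrite mul1r.
Qed.

Lemma meanZ B a h : bounded_by B h -> m (fun x => a * h x) = a * m h.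
Proof.
move=> /bounded_by_bounded_fun bh.
have b0 := @bounded_by_bounded_fun R G _ _ (@bounded_by_cst R G 0).
have [+ _ _ _ _] := mP => /(_ a _ _ bh b0); rewrite mean0 addr0 => <-.
by congr m; apply/funext => x; rewrite addr0.
Qed.

Lemma mean_cst a : m (fun=> a) = a.
Proof.
have := meanZ a (@bounded_by_cst R G 1).
by have [_ -> _ _ _] := mP; rewrite mulr1.
Qed.

Lemma meanMl B y h : bounded_by B h -> m (fun x => h (y * x)%g) = m h.
Proof.
by move=> /bounded_by_bounded_fun bh; have [_ _ _ + _] := mP; apply.
Qed.

Lemma meanMr B y h : bounded_by B h -> m (fun x => h (x * y)%g) = m h.
Proof.
by move=> /bounded_by_bounded_fun bh; have [_ _ _ _] := mP; apply.
Qed.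

Lemma mean_le1 h : bounded_by 1 h -> `|m h| <= 1.
Proof.
move=> h1; rewrite -[`|_|]RRe_real ?normr_real// (lecR _ 1).
have [_ _ n1 _ _] := mP; rewrite -n1 /mean_norm; apply: ub_le_sup; last by exists h.
(* On an unbounded set [sup] would take its default value 0, not 1. *)
apply: contrapT => nub; move: n1; rewrite /mean_norm sup_out; last by case.
by move=> /esym/eqP; rewrite oner_eq0.
Qed.

Lemma mean_le B h : 0 <= B -> bounded_by B h -> `|m h| <= B%:C.
Proof.
rewrite le_eqVlt => /predU1P[<- h0|B0 hB].
  rewrite (_ : h = fun=> 0) ?mean0 ?normr0//.
  by apply/funext => x; apply/eqP; rewrite -normr_le0 h0.
have BC0 : 0 < B%:C :> R[i] by rewrite (ltcR 0).
have := @mean_le1 (fun x => B%:C^-1 * h x).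
rewrite (meanZ _ hB) normrM normfV (gtr0_norm BC0) ler_pdivrMl// mulr1; apply.
by move=> x; rewrite normrM normfV (gtr0_norm BC0) ler_pdivrMl// mulr1 hB.
Qed.

End Mean.

(** * The averaged function and its defect *)

Section Averaging.
Set Implicit Arguments.
Unset Strict Implicit.
Variables (R : realType) (G : semigroupType) (m : (G -> R[i]) -> R[i]).
Variables (sigma : G -> G).
Hypotheses (mP : is_invariant_mean m) (sP : is_involution sigma).
Implicit Types (F : G -> R[i]) (B : R).

(** [F] itself may be unbounded; only this symmetrized sum is certain to lie in the domain where [m]
    is linear and invariant. *)
Lemma bounded_by_fiber B F x : bounded_by B (jdefect sigma F x) ->
  bounded_by (B + complex.Re `|2 * F x|)
    (fun y => F (x * y)%g + F (x * sigma y)%g).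
Proof.
move=> FB; rewrite (_ : (fun y => _) = fun y => jdefect sigma F x y + 2 * F x).
  exact: bounded_byD FB (@bounded_by_cst R G _).
by apply/funext => y; rewrite subrK.
Qed.

Lemma jdefect_javg B F : (forall x, bounded_by B (jdefect sigma F x)) ->
  forall x z, jdefect sigma (javg m sigma F) x z =
    - (2^-1 * m (fun y => jdefect sigma F y z + jdefect sigma F (sigma y) z)).
Proof.
case: sP => sM sK FB x z.
pose Phi t y := F (t * y)%g + F (t * sigma y)%g.
have bPhi t := bounded_by_fiber (FB t).
have bD (u : G -> G) : bounded_by B (fun y => jdefect sigma F (u y) z).
  by move=> y; exact: FB.
(* The first term is a left translate by [x]. For the second, [x * sigma y = sigma (y * sigma x)]
   makes it a right translate by [sigma x]. *)
have inv_x : m (fun y => jdefect sigma F (x * y)%g z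
                        + jdefect sigma F (x * sigma y)%g z)
    = m (fun y => jdefect sigma F y z + jdefect sigma F (sigma y) z).
  rewrite !(meanD mP (bD _) (bD _)); congr (_ + _).
    exact: (meanMl mP x (bD id)).
  rewrite -[RHS](meanMr mP (sigma x) (bD sigma)).
  by congr m; apply/funext => y; rewrite sM sK.
(* Both sides sum [F] over the same eight products. The right side regroups them into translates of
   [Phi x], so its mean is four times that of [Phi x]. *)
have four : m (fun y => (Phi (x * z)%g y + Phi (x * sigma z)%g y)
      + (jdefect sigma F (x * y)%g z + jdefect sigma F (x * sigma y)%g z)
      + 2 * Phi x y)
    = m (fun y => (Phi x (z * y)%g + Phi x (sigma z * y)%g)
      + (Phi x (y * z)%g + Phi x (y * sigma z)%g)).
  congr m; apply/funext => y; rewrite /Phi /jdefect !sM !sK !mulgA; ring.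
have bPc t (u : G -> G) : bounded_by _ (fun y => Phi t (u y)) := fun y => bPhi t (u y).
have b2 := bounded_byD (bPc (x * z)%g id) (bPc (x * sigma z)%g id).
have b3 := bounded_byD (bD (fun y => (x * y)%g)) (bD (fun y => (x * sigma y)%g)).
have bx u v := bounded_byD (bPc x u) (bPc x v).
move: four; rewrite (meanD mP (bounded_byD b2 b3) (bounded_byZ 2 (bPhi x))).
rewrite (meanD mP b2 b3) (meanD mP (bPc _ id) (bPc _ id)) inv_x.
rewrite (meanZ mP _ (bPhi x)) (meanD mP (bx _ _) (bx _ _)) !(meanD mP (bPc x _) (bPc x _)).
rewrite !(meanMl mP _ (bPhi x)) !(meanMr mP _ (bPhi x)).
set A := m _; set C := m _; set D := m _; set E := m _ => sumE.
rewrite -[LHS]/(2^-1 * A + 2^-1 * C - 2 * (2^-1 * E)).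
have -> : D = E + E + (E + E) - 2 * E - (A + C) by rewrite -sumE; ring.
by field.
Qed.

Lemma javgE B F x : bounded_by B (jdefect sigma F x) ->
  javg m sigma F x = F x + 2^-1 * m (jdefect sigma F x).
Proof.
move=> FB; rewrite /javg.
rewrite (_ : (fun y => _) = fun y => jdefect sigma F x y + 2 * F x); last first.
  by apply/funext => y; rewrite subrK.
rewrite (meanD mP FB (@bounded_by_cst R G _)) (mean_cst mP) mulrDr.
by rewrite mulKf ?pnatr_eq0// addrC.
Qed.

Lemma mean_half_le B (h : G -> R[i]) : 0 <= B -> bounded_by (2 * B) h ->
  `|2^-1 * m h| <= B%:C.
Proof.
move=> B0 hB; rewrite normrM normfV normr_nat ler_pdivrMl ?ltr0n//.
have := mean_le mP _ hB; rewrite rmorphM rmorph_nat; apply.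
by rewrite mulr_ge0.
Qed.

Lemma javg_dist B F x : 0 <= B -> bounded_by B (jdefect sigma F x) ->
  `|F x - javg m sigma F x| <= B%:C.
Proof.
move=> B0 FB; rewrite (javgE FB) opprD addNKr normrN mean_half_le// => y.
by rewrite (le_trans (FB y))// lecR; lra.
Qed.

Lemma jensen_javg B F : 0 <= B -> (forall x, bounded_by B (jdefect sigma F x)) ->
  jensen sigma (javg m sigma F).
Proof.
move=> B0 FB.
pose c z := 2^-1 * m (fun y => jdefect sigma F y z + jdefect sigma F (sigma y) z).
set F1 := javg m sigma F.
have dF1 x z : jdefect sigma F1 x z = - c z by rewrite (jdefect_javg FB).
(* The bound [B] survives averaging, so the average can itself be averaged. *)
have F1B x : bounded_by B (jdefect sigma F1 x).
  move=> z; rewrite dF1 normrN mean_half_le// mulr2n mulrDl mul1r.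
  by apply: bounded_byD => y; exact: FB.
have dF2 x z : jdefect sigma (javg m sigma F1) x z = c z.
  rewrite (jdefect_javg F1B) (_ : (fun y => _) = fun=> - c z - c z).
    by rewrite (mean_cst mP); field.
  by apply/funext => y; rewrite !dF1.
have F2E x : javg m sigma F1 x = F1 x + 2^-1 * m (fun y => - c y).
  rewrite (javgE (F1B x)); congr (_ + _ * m _).
  by apply/funext => y; rewrite dF1.
have c0 z (x : G) : c z = 0.
  (* Adding a constant leaves the defect unchanged, so [c z = - c z]. *)
  have c2 : c z + c z = 0.
    rewrite -{1}(dF2 x z) -[RHS](addNr (c z)) -(dF1 x z); congr (_ + _).
    by rewrite /jdefect !F2E; ring.
  by move/eqP: c2; rewrite -mulr2n mulrn_eq0 => /eqP.
move=> x z; apply/eqP; rewrite -subr_eq0 -[X in X == _]/(jdefect sigma F1 x z).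
by rewrite dF1 (c0 z x) oppr0.
Qed.

End Averaging.

(** * Uniqueness up to a constant *)

Lemma bounded_double_eq0 (R : realType) (G : monoidType) (B : R) (h : G -> R[i]) :
  bounded_by B h -> (forall x, h (x * x)%g = 2 * h x) -> forall x, h x = 0.
Proof.
move=> hB h2 x; set r := complex.Re `|h x|.
have hr y : (complex.Re `|h y|)%:C = `|h y| by rewrite RRe_real ?normr_real.
have pow n y : 2 ^+ n * complex.Re `|h y| <= B.
  elim: n y => [|n IHn] y; first by rewrite mul1r -lecR hr hB.
  apply: le_trans (IHn (y * y)%g); rewrite exprSr -mulrA ler_wpM2l//.
  by rewrite -lecR rmorphM rmorph_nat !hr h2 normrM normr_nat.
have r0 : 0 <= r by have := normr_ge0 (h x); rewrite -hr (lecR 0).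
apply/eqP; rewrite -normr_eq0 -hr -/r; apply/eqP; congr _%:C.
apply/eqP; apply: contraT => rn0.
have {rn0 r0} r0 : 0 < r by rewrite lt_neqAle eq_sym rn0.
(* This yields [B / r < 2 ^+ n] for [n = Num.bound (B / r)], contradicting [pow]. *)
have := upper_nthrootP (leqnn (Num.bound (B / r))).
by rewrite ltr_pdivrMr// ltNge pow.
Qed.

(** Jensen's equation at [(1, y)] makes [h] odd under [sigma]. As [sigma] fixes [x * sigma x], [h]
    vanishes there, and the equation at [(x, sigma x)] keeps only the square. *)
Lemma jensen_double (R : realType) (G : monoidType) (sigma : G -> G)
    (h : G -> R[i]) :
  is_involution sigma -> jensen sigma h -> h 1%g = 0 ->
  forall x, h (x * x)%g = 2 * h x.
Proof.
move=> [sM sK] hJ h1 x.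
have odd y : h (sigma y) = - h y.
  by apply/eqP; rewrite -addr_eq0 addrC -{1}[y]mul1g -[sigma y]mul1g hJ h1 mulr0.
have := hJ x (sigma x); rewrite sK.
have := odd (x * sigma x)%g; rewrite sM sK.
move=> /eqP; rewrite -addr_eq0 -mulr2n mulrn_eq0 => /eqP ->.
by rewrite add0r.
Qed.

Lemma jensen_bounded_dist (R : realType) (G : monoidType) (sigma : G -> G)
    (B : R) (g1 g2 : G -> R[i]) :
  is_involution sigma -> jensen sigma g1 -> jensen sigma g2 ->
  bounded_by B (fun x => g1 x - g2 x) ->
  forall x, g1 x = g2 x + (g1 1%g - g2 1%g).
Proof.
move=> sP J1 J2 gB x.
pose h y := (g1 y - g2 y) + - (g1 1%g - g2 1%g).
have hB := bounded_byD gB (@bounded_by_cst R G (- (g1 1%g - g2 1%g))).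
have hJ : jensen sigma h.
  move=> y z; have := J1 y z; have := J2 y z; rewrite /h => e2 e1.
  transitivity (2 * g1 y - 2 * g2 y + 2 * - (g1 1%g - g2 1%g)); last by ring.
  by rewrite -e1 -e2; ring.
have h1 : h 1%g = 0 by rewrite /h subrr.
have := bounded_double_eq0 hB (jensen_double sP hJ h1) x.
by rewrite /h => /eqP; rewrite subr_eq0 => /eqP <-; ring.
Qed.

(* Jensen's equation is invariant under adding constants, so a solution is
   unique once normalized by [g 1 = 0], and up to a constant otherwise. *)
Theorem theorem2p1 (R : realType) (G : monoidType) (sigma : G -> G)
    (f : G -> R[i]) (delta : R) :
  amenable R G ->
  is_involution sigma ->
  0 <= delta ->
  (forall x y : G,
     `|f (x * y)%g + f (x * sigma y)%g - 2 * f x| <= delta%:C) ->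
  (exists! g : G -> R[i],
     [/\ jensen sigma g,
         g 1%g = 0 &
         forall x : G, `|f x - g x - f 1%g| <= (3 * delta)%:C]) /\
  (forall g1 g2 : G -> R[i],
     jensen sigma g1 ->
     (forall x : G, `|f x - g1 x - f 1%g| <= (3 * delta)%:C) ->
     jensen sigma g2 ->
     (forall x : G, `|f x - g2 x - f 1%g| <= (3 * delta)%:C) ->
     exists c : R[i], forall x : G, g1 x = g2 x + c).
Proof.
move=> [m mP] sP d0 fd.
have uniq (g1 g2 : G -> R[i]) : jensen sigma g1 ->
    bounded_by (3 * delta) (fun x => f x - g1 x - f 1%g) -> jensen sigma g2 ->
    bounded_by (3 * delta) (fun x => f x - g2 x - f 1%g) ->
    forall x, g1 x = g2 x + (g1 1%g - g2 1%g).
  move=> J1 B1 J2 B2.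
  (* Both solutions are within [3 * delta] of [f - f 1], which bounds their difference. *)
  apply: (@jensen_bounded_dist _ _ _ (3 * delta + 3 * delta)) sP J1 J2 _ => x.
  rewrite (_ : g1 x - g2 x = (f x - g2 x - f 1%g) - (f x - g1 x - f 1%g)); last by ring.
  by rewrite (le_trans (ler_normB _ _))// rmorphD lerD.
split; last by move=> g1 g2 J1 B1 J2 B2; exists (g1 1%g - g2 1%g); exact: uniq.
pose h := javg m sigma f.
have hJ : jensen sigma h := jensen_javg mP sP d0 fd.
have dist y : `|f y - h y| <= delta%:C := javg_dist mP d0 (fd y).
pose g x := h x - h 1%g.
have gJ : jensen sigma g.
  move=> x y; transitivity (2 * h x - 2 * h 1%g); last by rewrite /g; ring.
  by rewrite -(hJ x y) /g; ring.
have g1 : g 1%g = 0 by rewrite /g subrr.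
have gB : bounded_by (3 * delta) (fun x => f x - g x - f 1%g).
  (* Normalizing at 1 costs a second copy of the distance from [f] to [h], for a total of at most
     [2 * delta]. *)
  move=> x; rewrite (_ : _ - _ = (f x - h x) - (f 1%g - h 1%g)); last by rewrite /g; ring.
  rewrite (le_trans (ler_normB _ _))// (le_trans (lerD (dist x) (dist 1%g)))//.
  by rewrite -rmorphD lecR; lra.
exists g; split=> [//|k [kJ k1 kB]]; apply/funext => x.
by rewrite (uniq g k gJ gB kJ kB) g1 k1 subrr addr0.
Qed.
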